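(* Let $k$ and $l'$ be positive integers with $l'<k$. If $\mathcal{F} \subseteq 2^{[n]}$ is an $(n-l')$-trace $k$-Sperner family, then $|\mathcal{F}| \le (k-l'+o(1))\binom{n}{\lfloor n/2\rfloor}$, where $o(1)$ denotes a quantity tending to $0$ as $n\to\infty$ with $k$ and $l'$ fixed.
   Context: $[n]=\{1,\dots,n\}$ and $2^{[n]}$ is the family of all subsets of $[n]$. A chain of length $m$ is a sequence of sets $F_1\subsetneq F_2\subsetneq\dots\subsetneq F_m$. A family is $k$-Sperner if it contains no chain of length $k+1$. For a set $F$ and a set $X$, the trace of $F$ on $X$ is $F\cap X$, and for a family $\mathcal{F}$, $\mathcal{F}|_X=\{F\cap X: F\in\mathcal{F}\}$. A family $\mathcal{F}\subseteq 2^{[n]}$ is $l$-trace $k$-Sperner if for every $l$-element subset $L\subseteq[n]$ the family $\mathcal{F}|_L$ is $k$-Sperner. *)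

(* Defs.v *)
From mathcomp Require Import all_boot all_order all_algebra.
Set Implicit Arguments. Unset Strict Implicit. Unset Printing Implicit Defensive.

Definition is_chain_in (n : nat) (G : {set {set 'I_n}}) (s : seq {set 'I_n}) :=
  all (fun A => A \in G) s && sorted (fun A B : {set 'I_n} => A \proper B) s.

Definition k_Sperner (n k : nat) (G : {set {set 'I_n}}) : Prop :=
  forall s : seq {set 'I_n}, is_chain_in G s -> size s <> k.+1.

Definition trace (n : nat) (G : {set {set 'I_n}}) (X : {set 'I_n}) : {set {set 'I_n}} :=
  [set F :&: X | F in G].

Definition trace_k_Sperner (n l k : nat) (G : {set {set 'I_n}}) : Prop :=
  forall L : {set 'I_n}, #|L| = l -> k_Sperner k (trace G L).

(* Main.v *)
(* Call [A] in [F] rich if, for every small set [Z], some swap [A - y + x] with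
   [x, y] outside [Z] is again in [F].  Toggling in each poor set [A] an element
   outside its blocking set hits every set boundedly often, so there are only
   O(2^n / n) = o('C(n, n./2)) poor sets.  Passing to the rich sets [l'] times
   therefore costs o('C(n, n./2)).  What remains has no chain of length
   [k - l' + 1]: starting from the bottom [A] of such a chain, [l'] successive
   swaps, each avoiding everything used before, give sets in [F] that, after
   deleting the [l'] elements swapped in, continue the chain downwards, so that
   the trace has a chain of length [k + 1].  Finally, the LYM inequality bounds
   a [(k - l')]-Sperner family by [(k - l') * 'C(n, n./2)]. *)
Require Import Defs.
From mathcomp Require Import all_boot all_order all_algebra.
From mathcomp Require Import zify ring lra.
Import Order.TTheory GRing.Theory Num.Theory.

Set Implicit Arguments.
Unset Strict Implicit.
Unset Printing Implicit Defensive.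

(** * Rich sets and the scarcity of poor sets *)

Definition swap_rich (T : finType) (c : nat) (H : {set {set T}}) :=
  [set A in H | [forall Z : {set T}, (#|Z| <= c) ==>
    [exists x, exists y, [&& x \notin Z, y \notin Z, x \notin A, y \in A
                           & x |: (A :\ y) \in H]]]].

Lemma swap_rich_sub (T : finType) c (H : {set {set T}}) : swap_rich c H \subset H.
Proof. by apply/subsetP=> A; rewrite inE => /andP[]. Qed.

Lemma iter_swap_rich_sub (T : finType) c (H : {set {set T}}) j :
  iter j (swap_rich c) H \subset H.
Proof. by elim: j => //= j; apply: subset_trans; apply: swap_rich_sub. Qed.

(** Double counting of pairs of a poor set and an element outside its blocking set. Toggling maps
    them to pairs of a set and a Boolean telling removal from insertion, whence the exponent
    [#|T|.+1]; fibres have size at most [c.+1]. *)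
Lemma card_swap_poor (T : finType) c (H : {set {set T}}) :
  #|H :\: swap_rich c H| * (#|T| - c) <= c.+1 * 2 ^ #|T|.+1.
Proof.
set B := H :\: _.
have BH A : A \in B -> A \in H by rewrite inE => /andP[].
(* [Z] picks a blocking set for each poor set; all other sets get the dummy [set0]. *)
have [Z ZP] : exists Z : {set T} -> {set T}, forall A, #|Z A| <= c /\
    (A \in B -> forall x y, x \notin Z A -> y \notin Z A -> x \notin A ->
       y \in A -> x |: (A :\ y) \notin H).
  suff /fin_all_exists[Z ZP] : forall A : {set T}, exists Z : {set T}, #|Z| <= c /\
      (A \in B -> forall x y, x \notin Z -> y \notin Z -> x \notin A ->
         y \in A -> x |: (A :\ y) \notin H) by exists Z.
  move=> A.
  case AB: (A \in B); last by exists set0; rewrite cards0.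
  move: AB; rewrite !inE negb_and => /andP[/orP[/negPf->//|]].
  case/forallPn=> Z; rewrite negb_imply => /andP[leZ /existsPn nZ] AH.
  exists Z; split=> // _ x y xZ yZ xA yA.
  have /existsPn/(_ y) := nZ x.
  by rewrite xZ yZ xA yA.
clearbody B.
pose E := [set p : {set T} * T | (p.1 \in B) && (p.2 \notin Z p.1)].
have lbE : #|B| * (#|T| - c) <= #|E|.
  rewrite -[leqRHS]sum1_card (eq_bigl (fun p => (p.1 \in B) && (p.2 \notin Z p.1)));
    last by move=> p; rewrite inE.
  rewrite -(pair_big_dep (mem B) (fun A v => v \notin Z A) (fun _ _ => 1)) /=.
  rewrite -sum_nat_const; apply: leq_sum => A _.
  rewrite sum1_card -[X in _ <= X](eq_card (A := ~: Z A));
    last by move=> v; rewrite !inE.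
  by rewrite cardsCs setCK leq_sub2l //; have [] := ZP A.
apply: leq_trans lbE _.
pose f (p : {set T} * T) := if p.2 \in p.1 then (p.1 :\ p.2, true)
                            else (p.2 |: p.1, false).
(* Two sets in one fibre of [f] differ by a swap, so the element toggled in the
   second one lies in the blocking set of the first. *)
have fibre q : #|[set p in E | f p == q]| <= c.+1.
  have [->|[[A0 v0]]] := set_0Vmem [set p in E | f p == q]; first by rewrite cards0.
  rewrite !inE /= => /andP[/andP[A0B v0Z] /eqP fq].
  have [leZ swapP] := ZP A0.
  have swapN := swapP A0B.
  (* The image and the toggled element determine the set, so a fibre is counted by its toggled
     elements. *)
  have inj : {in [set p in E | f p == q] &, injective snd}.
    move=> [A u] [A' u'] /=; rewrite !inE /= => /andP[_ /eqP fA] /andP[_ /eqP fA'] uu'.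
    congr (_, _) => //; subst u'; move: fA'; rewrite -fA /f /=.
    by case: ifP => uA'; case: ifP => uA // [] e;
      [rewrite -(setD1K uA) -(setD1K uA') e
      |rewrite -(setU1K (negbT uA)) -(setU1K (negbT uA')) e].
  rewrite -(card_in_imset inj).
  apply: leq_trans (_ : #|v0 |: Z A0| <= _); last by rewrite cardsU1 v0Z.
  apply/subset_leq_card/subsetP => u /imsetP[[A v]].
  rewrite !inE /= => /andP[/andP[AB vZ] /eqP fA] ->{u}.
  have [//|vv0] := eqVneq v v0; rewrite /=.
  apply/negPn/negP => vZ0; move: fA; rewrite -fq /f /=.
  case: ifP => vA; case: ifP => v0A0 // [] e.
  - have vA0 : v \notin A0.
      by apply: contraFN (setD11 v A); rewrite e !inE vv0.
    by have := swapN v v0 vZ0 v0Z vA0 v0A0; rewrite -e setD1K // BH.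
  - have vA0 : v \in A0.
      by have := setU11 v A; rewrite e !inE (negPf vv0).
    have := swapN v0 v v0Z vZ0 (negbT v0A0) vA0.
    suff -> : v0 |: A0 :\ v = A by rewrite BH.
    rewrite -(setU1K (negbT vA)) e; apply/setP=> w; rewrite !inE.
    by case: eqVneq => [->|]; rewrite ?vv0 1?eq_sym ?vv0.
rewrite -sum1_card (partition_big f xpredT) //=.
have -> : c.+1 * 2 ^ #|T|.+1 = \sum_(q : {set T} * bool) c.+1.
  have cT : #|{set T}| = 2 ^ #|T|.
    by have := card_powerset [set: T]; rewrite powersetT !cardsT.
  by rewrite sum_nat_const card_prod cT card_bool expnSr mulnC.
apply: leq_sum => q _; apply: leq_trans (fibre q).
by rewrite sum1dep_card; apply: eq_leq; apply: eq_card => p; rewrite !inE.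
Qed.

Lemma card_iter_swap_rich (T : finType) c (H : {set {set T}}) j :
  #|H| * (#|T| - c) <=
    #|iter j (swap_rich c) H| * (#|T| - c) + j * (c.+1 * 2 ^ #|T|.+1).
Proof.
elim: j => [|j IHj] /=; first by rewrite addn0.
apply: leq_trans IHj _; set G := iter _ _ _.
rewrite -(cardsID (swap_rich c G) G) (setIidPr (swap_rich_sub _ _)) mulnDl mulSn.
by rewrite -addnA leq_add2l leq_add2r card_swap_poor.
Qed.

(** * Lengthening chains downwards by swaps *)

(* The witness of strictness is kept in [Z], so that deleting further elements
   outside [Z] cannot collapse the chain. *)
Definition below_off (T : finType) (X Z B C : {set T}) :=
  (B :\: X \subset C :\: X) && ((C :\: B) :&: Z != set0).

Lemma below_off_mono (T : finType) (X X' Z Z' B C : {set T}) :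
  X \subset X' -> Z \subset Z' -> below_off X Z B C -> below_off X' Z' B C.
Proof.
move=> sX sZ /andP[sBC /set0Pn[z]]; rewrite !inE => /andP[zBC zZ].
apply/andP; split; last first.
  by apply/set0Pn; exists z; rewrite !inE zBC (subsetP sZ).
apply/subsetP=> w; rewrite !inE => /andP[wX wB]; rewrite wX /=.
have := subsetP sBC w; rewrite !inE wB andbT.
have -> : w \notin X by apply: contra wX; apply: (subsetP sX).
by move=> /(_ isT).
Qed.

Lemma below_off_proper (T : finType) (X Z B C : {set T}) : [disjoint X & Z] ->
  below_off X Z B C -> B :&: ~: X \proper C :&: ~: X.
Proof.
rewrite -!setDE => dXZ /andP[sBC /set0Pn[z]]; rewrite !inE => /andP[/andP[zB zC] zZ].
apply/properP; split=> //; exists z; rewrite !inE ?(negPf zB) ?andbF //.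
by rewrite zC andbT (disjointFl dXZ).
Qed.

Lemma chain_below_off (T : finType) (A : {set T}) t :
  path (fun B C : {set T} => B \proper C) A t ->
  exists2 Z : {set T}, #|Z| <= size t & path (below_off set0 Z) A t.
Proof.
elim: t A => [|C t IHt] A /=; first by exists set0; rewrite ?cards0.
case/andP=> /properP[sAC [z zC zA]] /IHt[Z leZ pZ].
exists (z |: Z); first by rewrite cardsU1; case: (z \notin Z); lia.
rewrite /below_off !setD0 sAC; apply/andP; split.
  by apply/set0Pn; exists z; rewrite !inE zA zC eqxx.
apply: sub_path pZ => B D; apply: below_off_mono => //; exact: subsetUr.
Qed.

(** Each swap avoids [X :|: Z]: [x] joins the elements to delete, and [y] joins [Z] as witness that
    the new bottom lies strictly below [A]. Each swap uses up two elements, hence the budget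
    [j.*2]. *)
Lemma swap_rich_extend (T : finType) c (F : {set {set T}}) j :
  forall (A X Z : {set T}) t, A \in iter j (swap_rich c) F ->
  all (fun B => B \in F) t -> path (below_off X Z) A t -> [disjoint X & Z] ->
  #|X| + #|Z| + j.*2 <= c ->
  exists (X' Z' : {set T}) (s : seq {set T}), [/\ #|X'| = #|X| + j, [disjoint X' & Z'],
    size s = (size t).+1 + j, all (fun B => B \in F) s
    & sorted (below_off X' Z') s].
Proof.
elim: j => [|j IHj] A X Z t /= AF tF pt dXZ le_c.
  by exists X, Z, (A :: t); rewrite !addn0 /= AF.
have AF' : A \in F by apply: (subsetP (iter_swap_rich_sub c F j.+1)).
move: AF; rewrite inE => /andP[Aj /forallP/(_ (X :|: Z))/implyP].
have leXZ : #|X :|: Z| <= c.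
  have [leU _] := leq_card_setU X Z.
  apply: leq_trans leU _; apply: leq_trans le_c; exact: leq_addr.
case/(_ leXZ)/existsP=> x /existsP[y /and5P[]].
rewrite !inE !negb_or => /andP[xX xZ] /andP[yX yZ] xA yA Gj.
have xy : x != y by apply: contraNneq xA => ->.
have := IHj _ (x |: X) (y |: Z) (A :: t) Gj.
case.
- by rewrite /= AF'.
- rewrite /=; apply/andP; split.
    apply/andP; split; last first.
      by apply/set0Pn; exists y; rewrite !inE yA eqxx eq_sym (negPf xy).
    apply/subsetP=> w; rewrite !inE.
    by case: (w == x) => //=; case/and3P=> -> _ ->.
  by apply: sub_path pt => B C; apply: below_off_mono; apply: subsetUr.
- apply/pred0P => w; rewrite /= !inE.
  have [->|_] := eqVneq w x; first by rewrite (negPf xy) (negPf xZ).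
  by have [->|_] := eqVneq w y; [rewrite (negPf yX)|apply: (pred0P dXZ)].
- by move: le_c; rewrite !cardsU1 xX yZ; clear; lia.
move=> X' [Z' [s [cX' d' ss sF sp]]]; exists X', Z', s; split=> //.
  by rewrite cX' cardsU1 xX add1n addSnnS.
by rewrite ss /= addnS.
Qed.

(** A chain of [k - l + 1] sets needs at most [k - l] witnesses, and [l] swaps use [2 * l] further
    elements; this is where [k + l] comes from. *)
Lemma iter_swap_rich_Sperner n k l c (F : {set {set 'I_n}}) :
  l <= k -> k + l <= c -> trace_k_Sperner (n - l) k F ->
  k_Sperner (k - l) (iter l (swap_rich c) F).
Proof.
move=> lk klc FP [//|A t] /andP[/=/andP[Al tl] pt] [st].
have [Z leZ pZ] := chain_below_off pt.
have tF : all (fun B => B \in F) t.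
  by apply: sub_all tl => B; apply: (subsetP (iter_swap_rich_sub c F l)).
have [||X [Z' [s [cX dX ss sF sp]]]] := swap_rich_extend Al tF pZ.
- by rewrite -setI_eq0 set0I.
- by rewrite cards0; lia.
rewrite cards0 add0n in cX.
have cXC : #|~: X| = n - l by rewrite cardsCs setCK card_ord cX.
apply: (FP _ cXC [seq B :&: ~: X | B <- s]); last first.
  by rewrite size_map ss st; lia.
apply/andP; split.
  by rewrite all_map; apply: sub_all sF => B BF; apply: imset_f.
by rewrite sorted_map; apply: sub_sorted sp => B C; apply: below_off_proper.
Qed.

(** * Size of the central binomial coefficient *)

Lemma leq_bin_half n m : 'C(n, m) <= 'C(n, n./2).
Proof.
have incr d : d <= n./2 -> 'C(n, n./2 - d) <= 'C(n, n./2).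
  elim: d => [|d IHd] ledn; first by rewrite subn0.
  apply: leq_trans (IHd (ltnW ledn)).
  have := mul_bin_left n (n./2 - d.+1).
  have -> : (n./2 - d.+1).+1 = n./2 - d by lia.
  have : n./2 - d <= n - (n./2 - d.+1) by lia.
  have : 0 < n./2 - d by lia.
  nia.
have small j : j <= n./2 -> 'C(n, j) <= 'C(n, n./2).
  by move=> lej; have := incr (n./2 - j) (leq_subr _ _); rewrite subKn.
have [/small//|gtm] := leqP m n./2.
have [ltnm|lemn] := ltnP n m; first by rewrite bin_small.
by rewrite -bin_sub //; apply: small; lia.
Qed.

(** Square-root-free form of ['C(2m, m) >= 4^m / (2 * sqrt m)]. The induction step rests on
    [4(m+1)(m+2) <= (2m+3)^2]. *)
Lemma exp4_leq_central_bin m : 0 < m -> 4 ^ m.*2 <= 4 * m * 'C(m.*2, m) ^ 2.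
Proof.
case: m => // m _; elim: m => [//|m IHm].
have rec : m.+2 * 'C(m.+2.*2, m.+2) = 2 * m.*2.+3 * 'C(m.+1.*2, m.+1).
  have e1 := mul_bin_diag m.+2.*2 m.+1.
  have e2 := mul_bin_down m.+2.*2.-1 m.+1.
  have e3 : m.+2.*2.-1.-1 = m.+1.*2 by lia.
  have e4 : m.+2.*2.-1 - m.+1 = m.+2 by lia.
  have e5 : m.+2.*2 = 2 * m.+2 by lia.
  rewrite -e1 {1}e5; rewrite e3 e4 in e2; rewrite -mulnA -e2.
  have -> : m.+2.*2.-1 = m.*2.+3 by lia.
  by rewrite mulnA.
set a := 'C(m.+1.*2, _) in IHm rec *; set b := 'C(_, _) in rec *.
have -> : 4 ^ m.+2.*2 = 4 * (4 * 4 ^ m.+1.*2) by rewrite doubleS !expnS.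
rewrite -(leq_pmul2l (ltn0Sn m.+1)).
have -> : m.+2 * (4 * m.+2 * b ^ 2) = 4 * (m.+2 * b) ^ 2 by ring.
by rewrite rec; nia.
Qed.

Lemma exp4_leq_bin_half n : 0 < n -> 4 ^ n <= 4 * n * 'C(n, n./2) ^ 2.
Proof.
move=> n_gt0; have := odd_double_half n; case: (odd n) => /=.
  (* An odd row is compared with the next even one, whose central entry is twice ['C(n, m)]. *)
  set m := n./2 => def_n.
  have := @exp4_leq_central_bin m.+1 isT.
  have -> : 'C(m.+1.*2, m.+1) = 2 * 'C(n, m).
    have -> : m.+1.*2 = n.+1 by lia.
    rewrite binS -(@bin_sub n m); last by lia.
    have -> : n - m = m.+1 by lia.
    lia.
  have -> : m.+1.*2 = n.+1 by lia.
  rewrite expnS; have : n >= m.+1 by lia.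
  by nia.
set m := n./2 => def_n.
have := @exp4_leq_central_bin m; rewrite -{2}def_n.
have -> : m.*2 = n by lia.
by move=> /(_ _) h; apply: leq_trans (h _) _; [lia|nia].
Qed.

Local Open Scope ring_scope.

Lemma exp2_little_o_bin_half (eps : rat) (c : nat) : 0 < eps ->
  exists N : nat, forall n : nat, (N <= n)%N ->
    (2 ^ n)%:R <= eps * (n - c)%N%:R * 'C(n, n./2)%:R.
Proof.
(* [n >= 2 * c] gives [n <= 2 * (n - c)], and [n > 16 / eps^2] then gives
   [4 * n <= eps^2 * (n - c)^2], which is what the squared claim needs. *)
move=> eps_gt0; pose b := Num.bound (16 * eps ^- 2).
exists (maxn 1 (maxn (2 * c) b)) => n; rewrite !geq_max => /and3P[n_gt0 le2c lebn].
have ltn : 16 * eps ^- 2 < n%:R.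
  apply: lt_le_trans (archi_boundP _) _; last by rewrite ler_nat.
  by rewrite mulr_ge0 // invr_ge0 exprn_ge0 ?ltW.
have lec : n%:R <= 2 * (n - c)%N%:R :> rat by rewrite -natrM ler_nat; lia.
have C_ge0 : 0 <= 'C(n, n./2)%:R :> rat by [].
rewrite -(@ler_pXn2r _ 2) ?nnegrE ?mulr_ge0 ?(ltW eps_gt0) //.
have h : (2 ^ n)%:R ^+ 2 <= 4 * n%:R * 'C(n, n./2)%:R ^+ 2 :> rat.
  by rewrite -!natrX -!natrM ler_nat -expnM mulnC expnM exp4_leq_bin_half.
apply: le_trans h _; rewrite !exprMn ler_wpM2r ?exprn_ge0 //.
have e2 : 0 < eps ^+ 2 by rewrite exprn_gt0.
have {}ltn : 16 < n%:R * eps ^+ 2 by rewrite -ltr_pdivrMr.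
have n0 : 0 < n%:R :> rat by rewrite ltr0n.
have sq : n%:R ^+ 2 <= 4 * (n - c)%N%:R ^+ 2 :> rat.
  have -> : 4 * (n - c)%N%:R ^+ 2 = (2 * (n - c)%N%:R) ^+ 2 :> rat by ring.
  by rewrite ler_pXn2r ?nnegrE ?ler0n ?mulr_ge0.
have h1 : 16 * n%:R <= n%:R * eps ^+ 2 * n%:R by rewrite ler_wpM2r ?ltW.
have h2 : eps ^+ 2 * n%:R ^+ 2 <= eps ^+ 2 * (4 * (n - c)%N%:R ^+ 2).
  by rewrite ler_wpM2l ?sq ?ltW.
lra.
Qed.
Local Close Scope ring_scope.

(** * The LYM inequality for [k]-Sperner families *)

Lemma k_Sperner_sub n k (G H : {set {set 'I_n}}) :
  G \subset H -> k_Sperner k H -> k_Sperner k G.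
Proof.
move=> sGH HP s /andP[sG ss]; apply: HP; rewrite /is_chain_in ss andbT.
by apply: sub_all sG => A; apply: (subsetP sGH).
Qed.

Lemma k_Sperner0 n (G : {set {set 'I_n}}) : k_Sperner 0 G -> G = set0.
Proof.
move=> GP; apply/eqP/set0Pn => -[A AG].
by apply: (GP [:: A]); rewrite // /is_chain_in /= AG.
Qed.

(** As the largest possible member, [V] can be put on top of every chain that avoids it. *)
Lemma k_Sperner_setD1 n k (V : {set 'I_n}) (G : {set {set 'I_n}}) :
  G \subset powerset V -> V \in G -> k_Sperner k.+1 G -> k_Sperner k (G :\ V).
Proof.
move=> sGV VG GP s /andP[sG ss] szs.
apply: (GP (rcons s V)); last by rewrite size_rcons szs.
apply/andP; split.
  rewrite all_rcons VG; apply: sub_all sG => A.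
  by rewrite !inE => /andP[].
case: s ss sG szs => // A s /= ss sG _; rewrite rcons_path ss /=.
have : last A s \in G :\ V by apply: (@allP _ _ (A :: s)) sG _ (mem_last A s).
rewrite !inE properEneq => /andP[-> lG].
by have := subsetP sGV _ lG; rewrite powersetE.
Qed.

Local Open Scope ring_scope.

(** The ground set is a variable [V] so that induction on its size can pass to [V :\ x]. If [V] is
    in [G], its term is 1 and removing it lowers [k] by one. *)
Lemma LYM_k_Sperner n k (V : {set 'I_n}) (G : {set {set 'I_n}}) :
  G \subset powerset V -> k_Sperner k G ->
  \sum_(A in G) ('C(#|V|, #|A|)%:R : rat)^-1 <= k%:R.
Proof.
elim: {V}_.+1 {-2}V (ltnSn #|V|) k G => // m IHm V leVm.
(* Averaging over the ground sets [V :\ x]. *)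
have avg k (G : {set {set 'I_n}}) : G \subset powerset V -> V \notin G ->
    k_Sperner k G -> \sum_(A in G) ('C(#|V|, #|A|)%:R : rat)^-1 <= k%:R.
  move=> sGV VG GP.
  have [V0|[x0 x0V]] := set_0Vmem V.
    rewrite big1 ?ler0n // => A AG; move: VG (subsetP sGV A AG).
    by rewrite powersetE V0 subset0 => VG /eqP A0; rewrite -A0 AG in VG.
  have v_gt0 : 0 < #|V|%:R :> rat by rewrite ltr0n (cardD1 x0) x0V.
  rewrite -(ler_pM2l v_gt0).
  have -> : #|V|%:R * (\sum_(A in G) ('C(#|V|, #|A|)%:R : rat)^-1) =
      \sum_(x in V) \sum_(A in [set A in G | x \notin A])
        ('C(#|V :\ x|, #|A|)%:R : rat)^-1.
    have -> : \sum_(x in V) \sum_(A in [set A in G | x \notin A])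
          ('C(#|V :\ x|, #|A|)%:R : rat)^-1 =
        \sum_(x in V) \sum_(A in G | x \notin A) ('C(#|V|.-1, #|A|)%:R)^-1.
      apply: eq_bigr => x xV; apply: eq_big => [A|A _]; first by rewrite inE.
      by rewrite (cardsD1 x V) xV.
    rewrite (exchange_big_dep (mem G)) /=; last by move=> ? ? _ /andP[].
    rewrite mulr_sumr; apply: eq_bigr => A AG.
    have AV : A \proper V.
      rewrite properEneq -powersetE (subsetP sGV) // andbT.
      by apply: contraNneq VG => <-.
    rewrite (eq_bigl (fun x => x \in V :\: A)); last first.
      by move=> x; rewrite !inE AG andbC.
    (* [A] is counted once for each of the [#|V| - #|A|] elements of [V] outside it; [mul_bin_down]
       turns this count over the smaller binomial into [#|V|] over the larger. *)
    rewrite sumr_const -[_^-1 *+ _]mulr_natl cardsDS ?proper_sub //.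
    have ltAV := proper_card AV.
    have c1 : 'C(#|V|, #|A|)%:R != 0 :> rat by rewrite pnatr_eq0 -lt0n bin_gt0 ltnW.
    have c2 : 'C(#|V|.-1, #|A|)%:R != 0 :> rat by rewrite pnatr_eq0 -lt0n bin_gt0; lia.
    apply: (mulIf c1); rewrite divfK //; apply: (mulIf c2).
    rewrite -natrM mul_bin_down natrM mulrAC divfK //.
  rewrite mulr_natl -sumr_const; apply: (@ler_sum rat) => x xV; apply: IHm.
  - by move: leVm; rewrite (cardsD1 x V) xV; lia.
  - apply/subsetP=> A; rewrite !inE subsetD1 => /andP[AG ->].
    by have := subsetP sGV A AG; rewrite powersetE => ->.
  - by apply: k_Sperner_sub GP; apply/subsetP=> A; rewrite inE => /andP[].
move=> k G sGV GP; have [VG|VG] := boolP (V \in G); last exact: avg.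
case: k GP => [/k_Sperner0 G0|k GP]; first by rewrite G0 inE in VG.
rewrite (big_setD1 V) //= binn invr1 -natr1 addrC lerD2r.
apply: avg; rewrite ?setD11 //; first exact: subset_trans (subD1set _ _) sGV.
exact: k_Sperner_setD1 sGV VG GP.
Qed.

(** Every term of the LYM sum is at least [1 / 'C(n, n./2)]. *)
Lemma card_k_Sperner n k (G : {set {set 'I_n}}) :
  k_Sperner k G -> (#|G| <= k * 'C(n, n./2))%N.
Proof.
move=> GP; have sG : G \subset powerset setT.
  by apply/subsetP=> A _; rewrite powersetE subsetT.
have := LYM_k_Sperner sG GP; rewrite cardsT card_ord => lym.
have C_gt0 : 0 < 'C(n, n./2)%:R :> rat by rewrite ltr0n bin_gt0; lia.
rewrite -(ler_nat rat) natrM -ler_pdivrMr //; apply: le_trans lym.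
rewrite mulr_natl -sumr_const; apply: ler_sum => A _.
have lA : (#|A| <= n)%N by rewrite -[n in leqRHS]card_ord max_card.
by rewrite lef_pV2 ?posrE ?ltr0n ?bin_gt0 ?ler_nat ?leq_bin_half //; lia.
Qed.

(* |F| <= (k - l' + o(1)) * C(n, floor(n/2)), o(1) -> 0 as n -> oo (k, l' fixed). *)
Theorem theorem1p2 (k l' : nat) (hl' : (0 < l')%N) (hlk : (l' < k)%N) :
  forall eps : rat, 0 < eps ->
  exists N : nat, forall n : nat, (N <= n)%N ->
  forall F : {set {set 'I_n}},
    trace_k_Sperner (n - l') k F ->
    (#|F|%:R : rat) <= ((k - l')%N%:R + eps) * ('C(n, n./2))%:R.
Proof.
(* [c] is the budget for [l'] swaps along a chain. The loss over [l'] passes to rich sets,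
   multiplied by [n - c], is at most [D * 2 ^ n], so the little-o bound is used with [eps / D]. *)
move=> eps eps_gt0; pose c := (k + l')%N; pose D := (l' * (c.+1 * 2))%N.
have D_gt0 : 0 < D%:R :> rat by rewrite ltr0n !muln_gt0 hl'.
have [N NP] := exp2_little_o_bin_half c (divr_gt0 eps_gt0 D_gt0).
exists (maxn N c.+1) => n; rewrite geq_max => /andP[/NP leN ltcn] F FP.
have m_gt0 : 0 < (n - c)%N%:R :> rat by rewrite ltr0n subn_gt0.
have GP := card_k_Sperner (iter_swap_rich_Sperner (ltnW hlk) (leqnn c) FP).
have := card_iter_swap_rich c F l'; rewrite card_ord.
rewrite expnS mulnA mulnA -/D -(ler_nat rat) natrD !natrM => leF.
rewrite -(ler_pM2r m_gt0); apply: le_trans leF _.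
rewrite !mulrDl lerD //.
  by rewrite ler_wpM2r ?ler0n // -natrM ler_nat.
have : D%:R * (2 ^ n)%:R <= D%:R * (eps / D%:R * (n - c)%N%:R * 'C(n, n./2)%:R).
  by rewrite ler_pM2l.
have -> : D%:R * (eps / D%:R * (n - c)%N%:R * 'C(n, n./2)%:R) =
    eps * 'C(n, n./2)%:R * (n - c)%N%:R.
  by field; rewrite gt_eqF.
by rewrite /D !natrM mulrA.
Qed.
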